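(* The pedal map $P$ can be extended to a linear triangle map on all of $D$. That is, there is a linear triangle map $\tilde P:D\to D$ such that, for every triangle $T$ that is neither flat nor right (so that its pedal triangle is a non-flat triangle), $\tilde P$ maps the ordered shape of $T$ to the ordered shape of the pedal triangle of $T$.
   Context: A triangle is an ordered triple $x_1x_2x_3$ of distinct points in $\mathbb{C}$; it is flat if the three points are collinear. Angles are normalized by dividing by $\pi$, so the three interior angles of a triangle sum to $1$. The ordered shape of a triangle is the triple $(\alpha_1,\alpha_2,\alpha_3)$ of its normalized interior angles listed so that $\alpha_1\ge\alpha_2\ge\alpha_3$. Let $A=\{(x,y,z)\in\mathbb{R}^3: x+y+z=1\}$ and $D=\{(\alpha_1,\alpha_2,\alpha_3)\in A:\alpha_1\ge\alpha_2\ge\alpha_3\ge 0\}$, so that ordered shapes lie in $D$. Pedal triangle: given $T=x_1x_2x_3$ (indices mod 3), let $y_i$ be the foot of the perpendicular from $x_i$ to the line through $x_{i+1}$ and $x_{i+2}$; the pedal triangle of $T$ is $y_1y_2y_3$. The pedal map $P$ sends the ordered shape of $T$ to the ordered shape of its pedal triangle. Linear triangle maps: let $G$ be the group of $3\times 3$ matrices generated by the permutation matrices $P_{13}$ (swapping coordinates 1 and 3) and $P_{23}$ (swapping coordinates 2 and 3) and the matrix $\begin{bmatrix}1&0&1\\0&1&1\\0&0&-1\end{bmatrix}$. $G$ leaves $A$ invariant, and every $G$-orbit in $A$ contains exactly one point of $D$. For $v,v'\in A$ write $v\sim v'$ if $v'=gv$ for some $g\in G$. A map $f:D\to D$ is a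 linear triangle map if there is an invertible linear map $M:\mathbb{R}^3\to\mathbb{R}^3$ with $MA\subset A$ and such that $v\sim v'$ implies $Mv\sim Mv'$ for all $v,v'\in A$, for which $f(v)$ is the unique point of $D$ in the $G$-orbit of $Mv$, for every $v\in D$. *)

(* Defs.v *)
From mathcomp Require Import all_boot all_order all_algebra all_fingroup.
From mathcomp Require Import all_classical all_reals all_analysis.
From mathcomp Require Import complex lra ring.

Set Implicit Arguments.
Unset Strict Implicit.
Unset Printing Implicit Defensive.

Import Order.TTheory GRing.Theory Num.Theory.
Local Open Scope classical_set_scope.
Local Open Scope ring_scope.

(* The complex plane is [R[i]] for a real number type [R]; index arithmetic
   [i + 1], [i + 2] in ['I_3] is modulo 3. *)

Section Plane.
Variable R : realType.
Implicit Types (x y p q z w : R[i]) (T : 'I_3 -> R[i]).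

Definition dotc z w : R :=
  complex.Re z * complex.Re w + complex.Im z * complex.Im w.

Definition line p q : set R[i] := [set p + t%:C%C * (q - p) | t in [set: R]].

Definition is_triangle T : Prop := injective T.

Definition flat T : Prop :=
  exists p q, p != q /\ forall i, line p q (T i).

Definition angle T (i : 'I_3) : R :=
  let u := T (i + 1) - T i in
  let v := T (i + 2) - T i in
  acos (dotc u v / (complex.Re `|u| * complex.Re `|v|)) / pi.

Definition right_triangle T : Prop := exists i, angle T i = 1 / 2.

Definition ordered_shape T : 'cV[R]_3 :=
  \col_(k < 3) nth 0 (sort >=%R [seq angle T i | i : 'I_3]) k.

Definition foot x p q : R[i] :=
  p + (dotc (x - p) (q - p) / dotc (q - p) (q - p))%:C%C * (q - p).

Lemma footP x p q y : p != q ->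
  y = foot x p q <-> line p q y /\ dotc (x - y) (q - p) = 0.
Proof.
case: x p q y => [x1 x2] [p1 p2] [q1 q2] [y1 y2] pq.
have dn0 : (q1 - p1) * (q1 - p1) + (q2 - p2) * (q2 - p2) != 0.
  apply: contra pq; rewrite -!expr2 paddr_eq0 ?sqr_ge0 // !sqrf_eq0 !subr_eq0.
  by move=> /andP[/eqP -> /eqP ->].
rewrite /foot /line /dotc /=; split => [[-> ->]|[[t _ [<- <-]]]] /=.
  split; last by field.
  eexists; first exact: I.
  reflexivity.
move=> h.
set s := _ / _.
suff -> : s = t by [].
by apply: (mulIf dn0); rewrite divfK //; lra.
Qed.

(* If [T] has a right angle, this triple has coinciding entries. *)
Definition pedal T (i : 'I_3) : R[i] := foot (T i) (T (i + 1)) (T (i + 2)).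

End Plane.

Section LinearTriangleMaps.
Variable R : realType.

Definition planeA : set 'cV[R]_3 := [set v | \sum_i v i 0 = 1].

Definition domD : set 'cV[R]_3 :=
  [set v | [/\ planeA v, v 0 0 >= v 1 0, v 1 0 >= v 2 0 & v 2 0 >= 0]].

Inductive generated (n : nat) (S : set 'M[R]_n) : 'M[R]_n -> Prop :=
| generated_gen g of S g : generated S g
| generated_one : generated S 1%:M
| generated_mul g h of generated S g & generated S h : generated S (g *m h)
| generated_inv g of generated S g : generated S (invmx g).

Definition reflection_mx : 'M[R]_3 :=
  \matrix_(i, j) nth 0 (nth [::] [:: [:: 1; 0; 1];
                                     [:: 0; 1; 1];
                                     [:: 0; 0; -1]] i) j.

Definition groupG : set 'M[R]_3 :=
  generated [set perm_mx (tperm 0 2); perm_mx (tperm 1 2); reflection_mx].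

Definition simA (v v' : 'cV[R]_3) : Prop := exists2 g, groupG g & v' = g *m v.

Definition linear_triangle_map (f : {fun domD >-> domD}) : Prop :=
  exists M : 'M[R]_3,
    [/\ M \in unitmx,
        forall v, planeA v -> planeA (M *m v),
        forall v v', planeA v -> planeA v' ->
          simA v v' -> simA (M *m v) (M *m v') &
        forall v, domD v -> domD `&` simA (M *m v) = [set f v]].

End LinearTriangleMaps.

Arguments domD : clear implicits.

(* Main.v *)
(* For an acute triangle with angles a_i the pedal triangle has angles 1 - 2 a_i,
   which suggests M v = (v_1 + v_2 + v_3) (1, 1, 1) - 2 v. On the plane A, the
   group G acts by permutations, a global sign and integer translations, so the
   multiset of the cos (2 pi v_i) is constant on G-orbits; it also separates the
   points of D. A computation with coordinates gives
   cos^2 (pi b_i) = cos^2 (2 pi a_i) for the angle b_i of the pedal triangle at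
   the foot opposite to a_i, acute or obtuse alike. Hence the ordered shape of
   the pedal triangle has the same cosines as M applied to the ordered shape of
   the triangle, so it is the point of D in that orbit. *)
Require Import Defs.
From mathcomp Require Import all_boot all_order all_algebra all_fingroup.
From mathcomp Require Import all_classical all_reals all_analysis.
From mathcomp Require Import complex lra ring.

Set Implicit Arguments.
Unset Strict Implicit.
Unset Printing Implicit Defensive.

Import Order.TTheory GRing.Theory Num.Theory.
Local Open Scope classical_set_scope.
Local Open Scope ring_scope.

(** * The group [G] on explicit triples *)

Section Orbits.
Variable R : realType.
Implicit Types (a b c x y z : R) (v w : 'cV[R]_3) (g h : 'M[R]_3).

Definition col3 a b c : 'cV[R]_3 := \col_k [:: a; b; c]`_k.

Lemma sum_ord3 (F : 'I_3 -> R) : \sum_i F i = F 0 + F 1 + F 2.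
Proof.
rewrite !big_ord_recl big_ord0 addr0 addrA.
by congr (_ + F _ + F _); apply: val_inj.
Qed.

Lemma ord3P (P : 'I_3 -> Prop) : P 0 -> P 1 -> P 2 -> forall i, P i.
Proof.
move=> P0 P1 P2 [[|[|[|//]]] ilt].
- by rewrite (_ : Ordinal ilt = 0) //; apply: val_inj.
- by rewrite (_ : Ordinal ilt = 1) //; apply: val_inj.
- by rewrite (_ : Ordinal ilt = 2) //; apply: val_inj.
Qed.

Lemma col3E v : v = col3 (v 0 0) (v 1 0) (v 2 0).
Proof. by apply/colP; apply: ord3P; rewrite !mxE. Qed.

Lemma col3P (P : 'cV[R]_3 -> Prop) : (forall a b c, P (col3 a b c)) -> forall v, P v.
Proof. by move=> Pcol v; rewrite (col3E v). Qed.

Lemma mulmx_col3 g a b c :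
  g *m col3 a b c = col3 (g 0 0 * a + g 0 1 * b + g 0 2 * c)
                         (g 1 0 * a + g 1 1 * b + g 1 2 * c)
                         (g 2 0 * a + g 2 1 * b + g 2 2 * c).
Proof. by apply/colP; apply: ord3P; rewrite !mxE sum_ord3 !mxE. Qed.

(** The columns of a matrix are its products with basis vectors, so triples detect equality; matrix
    identities thereby become [ring] goals. *)
Lemma eq_mx_col3 g h :
  (forall a b c, g *m col3 a b c = h *m col3 a b c) -> g = h.
Proof.
move=> gh; apply/trmx_inj/row_matrixP => j; rewrite -!tr_col !colE.
by rewrite (col3E (delta_mx j 0)) gh.
Qed.

Lemma planeA_col3 a b c : planeA (col3 a b c) = (a + b + c = 1).
Proof. by rewrite /planeA /= sum_ord3 !mxE. Qed.

Lemma domD_col3 a b c :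
  domD R (col3 a b c) = [/\ a + b + c = 1, b <= a, c <= b & 0 <= c] :> Prop.
Proof. by rewrite /domD /= planeA_col3 !mxE. Qed.

Lemma swap02_col3 a b c : perm_mx (tperm 0 2) *m col3 a b c = col3 c b a.
Proof.
by rewrite mulmx_col3 !mxE !permE /=; congr col3; ring.
Qed.

Lemma swap12_col3 a b c : perm_mx (tperm 1 2) *m col3 a b c = col3 a c b.
Proof.
by rewrite mulmx_col3 !mxE !permE /=; congr col3; ring.
Qed.

Lemma reflection_col3 a b c :
  reflection_mx R *m col3 a b c = col3 (a + c) (b + c) (- c).
Proof. by rewrite mulmx_col3 !mxE /=; congr col3; ring. Qed.

Lemma simA_refl v : simA v v.
Proof. by exists 1%:M; [exact: generated_one | rewrite mul1mx]. Qed.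

Lemma simA_trans v2 v1 v3 : simA v1 v2 -> simA v2 v3 -> simA v1 v3.
Proof.
move=> [g Gg ->] [h Gh ->]; exists (h *m g); last by rewrite mulmxA.
exact: generated_mul.
Qed.

Lemma simA_swap02 a b c : simA (col3 a b c) (col3 c b a).
Proof.
exists (perm_mx (tperm 0 2)); last by rewrite swap02_col3.
by apply: generated_gen; left; left.
Qed.

Lemma simA_swap12 a b c : simA (col3 a b c) (col3 a c b).
Proof.
exists (perm_mx (tperm 1 2)); last by rewrite swap12_col3.
by apply: generated_gen; left; right.
Qed.

Lemma simA_swap01 a b c : simA (col3 a b c) (col3 b a c).
Proof.
apply: simA_trans (simA_swap12 a b c) _.
exact: simA_trans (simA_swap02 a c b) (simA_swap12 b c a).
Qed.

Lemma simA_reflection a b c : simA (col3 a b c) (col3 (a + c) (b + c) (- c)).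
Proof.
exists (reflection_mx R); last by rewrite reflection_col3.
by apply: generated_gen; right.
Qed.

(** Transpositions in [G] do the sorting: the first two entries are ordered by symmetry, then the
    third is inserted. *)
Lemma simA_sorted a b c : a + b + c = 1 -> 0 <= a -> 0 <= b -> 0 <= c ->
  exists2 w, domD R w & simA (col3 a b c) w.
Proof.
wlog ba : a b c / b <= a.
  move=> hw abc a0 b0 c0; have [ba|/ltW ab] := leP b a; first exact: hw.
  have [w Dw sw] := hw b a c ab ltac:(lra) b0 a0 c0.
  by exists w => //; apply: simA_trans (simA_swap01 a b c) sw.
move=> abc a0 b0 c0; have [cb|/ltW bc] := leP c b.
  by exists (col3 a b c); [rewrite domD_col3 | exact: simA_refl].
have [ca|/ltW ac] := leP c a.
  by exists (col3 a c b); [rewrite domD_col3; split=> //; lra | exact: simA_swap12].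
exists (col3 c a b); first by rewrite domD_col3; split=> //; lra.
exact: simA_trans (simA_swap12 a b c) (simA_swap01 a c b).
Qed.

(** * The pedal matrix and its compatibility with [G] *)

Definition pedal_mx : 'M[R]_3 := const_mx 1 - 2%:M.

Lemma pedal_mx_col3 a b c : pedal_mx *m col3 a b c =
  col3 (a + b + c - 2 * a) (a + b + c - 2 * b) (a + b + c - 2 * c).
Proof. by rewrite mulmx_col3 !mxE /=; congr col3; ring. Qed.

Lemma pedal_mx_unit : pedal_mx \in unitmx.
Proof.
(* The all-ones matrix [J] satisfies [J^2 = 3 J], hence [(J - 2)(J - 1) = 2]. *)
suff : pedal_mx *m (2^-1 *: (const_mx 1 - 1%:M)) = 1%:M.
  by case/mulmx1_unit.
apply: eq_mx_col3 => a b c; rewrite -mulmxA mul1mx.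
rewrite [X in _ *m X]mulmx_col3 !mxE /= pedal_mx_col3.
by congr col3; field.
Qed.

Lemma pedal_mx_planeA v : planeA v -> planeA (pedal_mx *m v).
Proof.
elim/col3P: v => a b c; rewrite pedal_mx_col3 !planeA_col3 => abc; lra.
Qed.

(** Intertwining relations compose and invert, so the generators decide; this is what makes the
    pedal matrix respect orbits. *)
Lemma groupG_pedal_mx g : groupG g ->
  exists2 h, groupG h & pedal_mx *m g = h *m pedal_mx.
Proof.
elim=> {g} [g Sg||g1 g2 _ [h1 Gh1 e1] _ [h2 Gh2 e2]|g _ [h Gh e]].
- have G02 : groupG (perm_mx (tperm 0 2) : 'M[R]_3).
    by apply: generated_gen; left; left.
  have G12 : groupG (perm_mx (tperm 1 2) : 'M[R]_3).
    by apply: generated_gen; left; right.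
  have Gr : groupG (reflection_mx R) by apply: generated_gen; right.
  case: Sg => [[]|] ->.
  + exists (perm_mx (tperm 0 2)) => //; apply: eq_mx_col3 => a b c.
    by rewrite -!mulmxA pedal_mx_col3 !swap02_col3 pedal_mx_col3; congr col3; ring.
  + exists (perm_mx (tperm 1 2)) => //; apply: eq_mx_col3 => a b c.
    by rewrite -!mulmxA pedal_mx_col3 !swap12_col3 pedal_mx_col3; congr col3; ring.
  + (* The pedal matrix turns the reflection in the line z = 0 into the one in
       z = 1, a conjugate of the reflection in y = 0 by that in x = 0. *)
    pose r0 := perm_mx (tperm 0 2) *m (reflection_mx R *m perm_mx (tperm 0 2)).
    pose r1 := perm_mx (tperm 1 2) *m (reflection_mx R *m perm_mx (tperm 1 2)).
    exists (r0 *m (r1 *m r0)).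
      by do ![exact: G02 | exact: G12 | exact: Gr | apply: generated_mul].
    apply: eq_mx_col3 => a b c; rewrite /r0 /r1 -!mulmxA pedal_mx_col3.
    rewrite !(swap02_col3, swap12_col3, reflection_col3) pedal_mx_col3.
    by congr col3; ring.
- by exists 1%:M; [exact: generated_one | rewrite mul1mx mulmx1].
- exists (h1 *m h2); first exact: generated_mul.
  by rewrite mulmxA e1 -mulmxA e2 mulmxA.
(* [invmx] returns a singular matrix unchanged, so that case reuses [h]. *)
- have [gU|gU] := boolP (g \in unitmx); last first.
    by exists h => //; rewrite /invmx (negbTE gU).
  exists (invmx h); first exact: generated_inv.
  have hU : h \in unitmx.
    have : pedal_mx *m g \in unitmx by rewrite unitmx_mul pedal_mx_unit.
    by rewrite e unitmx_mul => /andP[].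
  rewrite -[LHS](mulKmx hU) [h *m _]mulmxA -e -[_ *m g *m _]mulmxA mulmxV //.
  by rewrite mulmx1.
Qed.

Lemma simA_pedal_mx v w : simA v w -> simA (pedal_mx *m v) (pedal_mx *m w).
Proof.
move=> [g /groupG_pedal_mx [h Gh e] ->]; exists h => //.
by rewrite !mulmxA e.
Qed.

Lemma simA_pedal_domD v : domD R v ->
  exists2 w, domD R w & simA (pedal_mx *m v) w.
Proof.
elim/col3P: v => x y z; rewrite domD_col3 => -[s yx zy z0]; rewrite pedal_mx_col3 s.
(* Since [x] is the largest entry, [2 * x <= 1] makes all three image entries nonnegative. *)
have [x2|x2] := leP (2 * x) 1; first by apply: simA_sorted; lra.
(* Reflecting in x = 0 gives the angles (2x - 1, 2z, 2y) of the obtuse case. *)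
have [||||w Dw sw] := @simA_sorted (2 * y) (2 * z) (2 * x - 1); try lra.
exists w => //; apply: simA_trans (simA_swap02 _ _ _) _.
apply: simA_trans (simA_reflection _ _ _) _.
by move: sw; congr (simA (col3 _ _ _) w); lra.
Qed.

(** * Cosines as a complete invariant of orbits in the plane [A] *)

Definition cosines v : seq R :=
  [:: cos (2 * v 0 0 * pi); cos (2 * v 1 0 * pi); cos (2 * v 2 0 * pi)].

Lemma cosines_col3 a b c : cosines (col3 a b c) =
  [:: cos (2 * a * pi); cos (2 * b * pi); cos (2 * c * pi)].
Proof. by rewrite /cosines !mxE. Qed.

Lemma cos_2pi_sub x y : x + y = 1 -> cos (2 * x * pi) = cos (2 * y * pi).
Proof.
move=> xy; have -> : 2 * x * pi = - (2 * y * pi) + pi *+ 2.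
  by rewrite (_ : x = 1 - y) ?mulr2n; [ring | lra].
by rewrite cosD2pi cosN.
Qed.

Lemma perm_swap02 (T : eqType) (a b c : T) : perm_eq [:: c; b; a] [:: a; b; c].
Proof. by have := perm_refl [:: a; b; c]; rewrite -{1}perm_rev. Qed.

Lemma perm_swap12 (T : eqType) (a b c : T) : perm_eq [:: a; c; b] [:: a; b; c].
Proof. by rewrite perm_cons (perm_catC [:: c] [:: b]). Qed.

Lemma perm_swap01 (T : eqType) (a b c : T) : perm_eq [:: b; a; c] [:: a; b; c].
Proof. by rewrite (perm_catCA [:: b] [:: a] [:: c]). Qed.

(** The induction also carries preservation of the coordinate sum, so that the intermediate vectors
    of products and inverses stay in the plane. *)
Lemma cosines_groupG g v : groupG g -> planeA v ->
  perm_eq (cosines (g *m v)) (cosines v).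
Proof.
move=> Gg; suff [_] : (forall v, \sum_i (g *m v) i 0 = \sum_i v i 0) /\
    (forall v, planeA v -> perm_eq (cosines (g *m v)) (cosines v)) by exact.
elim: Gg => {g v} [g Sg||g h _ [gs gc] _ [hs hc]|g Gg [gs gc]].
- split; elim/col3P => a b c; case: Sg => [[]|] ->.
  1-6: rewrite ?swap02_col3 ?swap12_col3 ?reflection_col3.
  1-3: by rewrite !sum_ord3 !mxE /=; ring.
  1-3: rewrite !cosines_col3 planeA_col3 => abc.
  + exact: perm_swap02.
  + exact: perm_swap12.
  (* On the plane, [a + c = 1 - b] and [b + c = 1 - a]: the reflection exchanges the first two
     cosines. *)
  + rewrite mulrN mulNr cosN (@cos_2pi_sub (a + c) b) ?(@cos_2pi_sub (b + c) a); try lra.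
    exact: perm_swap01.
- by split=> [v|v _]; rewrite mul1mx.
- split=> [v|v Av]; rewrite -mulmxA ?gs ?hs //.
  by apply: perm_trans (gc _ _) (hc _ _); rewrite /planeA /= ?hs.
- have [gU|gU] := boolP (g \in unitmx); last by rewrite /invmx (negbTE gU).
  have gV v : \sum_i (invmx g *m v) i 0 = \sum_i v i 0.
    by rewrite -(gs (invmx g *m v)) mulKVmx.
  split=> // v Av; rewrite perm_sym -{1}(mulKVmx gU v).
  by apply: gc; rewrite /planeA /= gV.
Qed.

(** On [[0, 1/2]] the argument stays in [[0, pi]], where cosine is injective; a point beyond [1/2]
    is first folded to [1 - x], which keeps the cosine. *)
Lemma cos_2pi_inj x y : 0 <= x <= 1 -> 0 <= y <= 1 ->
  cos (2 * x * pi) = cos (2 * y * pi) -> x = y \/ x + y = 1.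
Proof.
have piN0 : pi != 0 :> R by rewrite gt_eqF ?pi_gt0.
have inj (s t : R) : 0 <= s <= 2^-1 -> 0 <= t <= 2^-1 ->
    cos (2 * s * pi) = cos (2 * t * pi) -> s = t.
  have half (r : R) : 0 <= r <= 2^-1 -> 2 * r * pi \in `[0, pi].
    move=> /andP[r0 r1]; have p0 := pi_ge0 R.
    rewrite in_itv /=; apply/andP; split; first by rewrite !mulr_ge0.
    by rewrite -[leRHS]mul1r; apply: ler_wpM2r => //; lra.
  move=> sI tI /cos_inj => /(_ (half _ sI) (half _ tI)) /(mulIf piN0) e; lra.
move=> /andP[x0 x1] /andP[y0 y1].
have [xh|xh] := leP x 2^-1; have [yh|yh] := leP y 2^-1.
- by move=> e; left; apply: inj => //; lra.
- rewrite (@cos_2pi_sub y (1 - y)) => [e|]; last lra.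
  by right; rewrite (inj x (1 - y) _ _ e); lra.
- rewrite (@cos_2pi_sub x (1 - x)) => [e|]; last lra.
  by right; rewrite -(inj (1 - x) y _ _ e); lra.
- rewrite (@cos_2pi_sub x (1 - x)) ?(@cos_2pi_sub y (1 - y)); try lra.
  by move=> e; left; apply: (subrI 1); apply: inj => //; lra.
Qed.

Lemma perm_eq3 (T : eqType) (a b c a' b' c' : T) :
  perm_eq [:: a; b; c] [:: a'; b'; c'] ->
  [\/ [/\ a = a', b = b' & c = c'] \/ [/\ a = a', b = c' & c = b'],
      [/\ a = b', b = a' & c = c'] \/ [/\ a = b', b = c' & c = a'] |
      [/\ a = c', b = a' & c = b'] \/ [/\ a = c', b = b' & c = a']].
Proof.
have pair (x y x' y' : T) : perm_eq [:: x; y] [:: x'; y'] ->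
    (x = x' /\ y = y') \/ (x = y' /\ y = x').
  move=> e; have : x \in [:: x'; y'] by rewrite -(perm_mem e) mem_head.
  rewrite !inE => /orP[]/eqP ex; subst x; [left|right].
    by move: e; rewrite perm_cons => /(@perm_small_eq _ _ [:: _] isT) [->].
  move: e; rewrite perm_sym (perm_catC [:: x'] [:: y']).
  by rewrite perm_cons => /(@perm_small_eq _ _ [:: _] isT) [->].
move=> e; have : a \in [:: a'; b'; c'] by rewrite -(perm_mem e) mem_head.
rewrite !inE => /or3P[]/eqP ea; subst a.
- by move: e; rewrite perm_cons => /pair[][-> ->]; constructor 1; [left|right].
- move: e; rewrite perm_sym (perm_catCA [:: a'] [:: b'] [:: c']) perm_cons.
  by move=> /pair[][-> ->]; constructor 2; [left|right].
- move: e; rewrite perm_sym (perm_catC [:: a'; b'] [:: c']) perm_cons.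
  by move=> /pair[][-> ->]; constructor 3; [left|right].
Qed.

(** Each of the six matchings pairs entries that are equal or sum to 1; the inequalities of [D]
    settle every combination linearly. *)
Lemma cosines_domD_inj v w : domD R v -> domD R w ->
  perm_eq (cosines v) (cosines w) -> v = w.
Proof.
elim/col3P: v => a b c; elim/col3P: w => a' b' c'.
rewrite !domD_col3 => -[s ba cb c0] [s' ba' cb' c0'].
rewrite !cosines_col3 => e.
suff [-> -> ->] : [/\ a = a', b = b' & c = c'] by [].
have aI : 0 <= a <= 1 by lra.
have bI : 0 <= b <= 1 by lra.
have cI : 0 <= c <= 1 by lra.
have a'I : 0 <= a' <= 1 by lra.
have b'I : 0 <= b' <= 1 by lra.
have c'I : 0 <= c' <= 1 by lra.
by case/perm_eq3: e => -[] [/cos_2pi_inj e1 /cos_2pi_inj e2 /cos_2pi_inj e3];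
  case: e1 => // e1; case: e2 => // e2; case: e3 => // e3; split; lra.
Qed.

End Orbits.

(** * Angles between plane vectors and the angle sum *)

Section Triangles.
Variable R : realType.
Implicit Types (u v w A B C : R[i]) (T : 'I_3 -> R[i]).

(** Twice the signed area of the triangle spanned by [u] and [v]; its nonvanishing is the working
    form of non-flatness. *)
Definition crossc u v : R :=
  complex.Re u * complex.Im v - complex.Im u * complex.Re v.

(** The norm of a complex number is itself complex-valued, hence the real part. *)
Definition vnorm u : R := complex.Re `|u|.

Definition vangle u v : R := acos (dotc u v / (vnorm u * vnorm v)).

Lemma vnorm_ge0 u : 0 <= vnorm u.
Proof. by rewrite /vnorm normc_def /= sqrtr_ge0. Qed.

Lemma vnormN u : vnorm (- u) = vnorm u.
Proof. by rewrite /vnorm normrN. Qed.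

Lemma sqr_vnorm u : vnorm u ^+ 2 = dotc u u.
Proof.
by rewrite /vnorm /dotc normc_def /= sqr_sqrtr -?expr2 // addr_ge0 ?sqr_ge0.
Qed.

Lemma dotc_gt0 u v : crossc u v != 0 -> 0 < dotc u u.
Proof.
move=> uv; rewrite lt0r -sqr_vnorm sqr_ge0 andbT sqr_vnorm.
apply: contra uv; rewrite /dotc -!expr2 paddr_eq0 ?sqr_ge0 // !sqrf_eq0.
by move=> /andP[/eqP u1 /eqP u2]; rewrite /crossc u1 u2 !mul0r subr0.
Qed.

Lemma vnorm_gt0 u v : crossc u v != 0 -> 0 < vnorm u.
Proof.
move=> /dotc_gt0; rewrite -sqr_vnorm lt0r sqrf_eq0 => /andP[uN0 _].
by rewrite lt0r uN0 vnorm_ge0.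
Qed.

Lemma crossc_swap u v : crossc v u = - crossc u v.
Proof. by rewrite /crossc; ring. Qed.

(** Lagrange's identity, the source of both Cauchy-Schwarz and the formula for the sine. *)
Lemma dotc_crossc u v :
  dotc u v ^+ 2 + crossc u v ^+ 2 = dotc u u * dotc v v.
Proof. by rewrite /dotc /crossc; ring. Qed.

Section NonzeroCross.
Variables u v : R[i].
Hypothesis uv : crossc u v != 0.

Let normM_gt0 : 0 < vnorm u * vnorm v.
Proof.
by rewrite mulr_gt0 ?(vnorm_gt0 uv) // (@vnorm_gt0 v u) // crossc_swap oppr_eq0.
Qed.

(** Cauchy-Schwarz; [acos] inverts [cos] only on this interval. *)
Lemma cos_arg_itv : -1 <= dotc u v / (vnorm u * vnorm v) <= 1.
Proof.
rewrite -ler_norml normrM normfV (gtr0_norm normM_gt0) ler_pdivrMr // mul1r.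
rewrite -ler_sqr ?nnegrE ?normr_ge0 ?(ltW normM_gt0) // real_normK ?num_real //.
by rewrite exprMn !sqr_vnorm -dotc_crossc lerDl sqr_ge0.
Qed.

Lemma vangle_itv : 0 <= vangle u v <= pi.
Proof. by rewrite acos_ge0 ?acos_lepi ?cos_arg_itv. Qed.

Lemma cos_vangle : cos (vangle u v) * (vnorm u * vnorm v) = dotc u v.
Proof.
by rewrite acosK ?in_itv /= ?cos_arg_itv // divfK // gt_eqF.
Qed.

(** The angle is unoriented, in [[0, pi]], so its sine is nonnegative and comparing squares
    suffices. *)
Lemma sin_vangle : sin (vangle u v) * (vnorm u * vnorm v) = `|crossc u v|.
Proof.
apply/eqP; rewrite -(@eqrXn2 _ 2) ?normr_ge0 //; last first.
  by rewrite mulr_ge0 ?sin_ge0_pi ?vangle_itv // ltW.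
rewrite real_normK ?num_real // exprMn sin2cos2 mulrBl mul1r -exprMn cos_vangle.
by rewrite exprMn !sqr_vnorm -dotc_crossc addrC addKr.
Qed.

Lemma sqr_cos_vangle : cos (vangle u v) ^+ 2 = dotc u v ^+ 2 / (dotc u u * dotc v v).
Proof.
rewrite -cos_vangle exprMn -!sqr_vnorm -(exprMn _ (vnorm u)) mulfK //.
by rewrite sqrf_eq0 gt_eqF.
Qed.

End NonzeroCross.

(** For angles [al], [be], [ga], the addition formulas give [cos (al + be) = - cos ga] and
    [sin (al + be) > 0]. The latter forces [al + be < pi], and cosine is injective on [[0, pi]]. *)
Lemma vangle_sum A B C : crossc (B - A) (C - A) != 0 ->
  vangle (B - A) (C - A) + vangle (C - B) (A - B) + vangle (A - C) (B - C) = pi.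
Proof.
move=> kA.
have [eB eC] : crossc (C - B) (A - B) = crossc (B - A) (C - A) /\
               crossc (A - C) (B - C) = crossc (B - A) (C - A).
  by case: A B C {kA} => [? ?] [? ?] [? ?]; rewrite /crossc /=; split; ring.
have [kB kC] : crossc (C - B) (A - B) != 0 /\ crossc (A - C) (B - C) != 0.
  by rewrite eB eC.
have := (cos_vangle kC, cos_vangle kB, cos_vangle kA).
have := (sin_vangle kC, sin_vangle kB, sin_vangle kA).
rewrite eB eC -![vnorm (A - _)]vnormN -[vnorm (B - C)]vnormN !opprB.
have /vnorm_gt0 := kA; have /vnorm_gt0 := kB.
have : crossc (C - A) (B - A) != 0 by rewrite crossc_swap oppr_eq0.
move/vnorm_gt0; have := sqr_vnorm (B - A).
have := (vangle_itv kC, vangle_itv kB, vangle_itv kA).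
(* The numerator of [cos (al + be)]; [dotD] below serves the sine in the same way. *)
have dots : dotc (B - A) (C - A) * dotc (C - B) (A - B) - crossc (B - A) (C - A) ^+ 2
    = - dotc (A - C) (B - C) * dotc (B - A) (B - A).
  by case: A B C {kA kB kC eB eC} => [? ?] [? ?] [? ?]; rewrite /dotc /crossc /=; ring.
have dotD : dotc (B - A) (C - A) + dotc (C - B) (A - B) = dotc (B - A) (B - A).
  by case: A B C {kA kB kC eB eC dots} => [? ?] [? ?] [? ?]; rewrite /dotc /=; ring.
move: dots dotD; rewrite -(real_normK (num_real (crossc _ _))).
move: kA; rewrite -normr_gt0.
set al := vangle (B - A) _; set be := vangle (C - B) _; set ga := vangle (A - C) _.
set k := `|_|; set d1 := dotc (B - A) (C - A); set d2 := dotc (C - B) _.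
set d3 := dotc (A - C) _; set n := dotc (B - A) (B - A).
set p := vnorm (B - A); set q := vnorm (C - B); set s := vnorm (C - A).
move=> k0 dots dotD [[/andP[ga0 gapi] /andP[be0 bepi]] /andP[al0 alpi]] pn.
move=> s0 q0 p0 [[sga sbe] sal] [[cga cbe] cal].
have D0 : 0 < p * s * (q * p) by rewrite !mulr_gt0.
have cosE : cos (al + be) = - cos ga.
  apply: (mulIf (lt0r_neq0 D0)); rewrite cosD.
  transitivity (cos al * (p * s) * (cos be * (q * p)) -
                sin al * (p * s) * (sin be * (q * p))); first by ring.
  rewrite cal cbe sal sbe -expr2 dots -pn -cga; ring.
have sin0 : 0 < sin (al + be).
  rewrite -(pmulr_lgt0 _ D0) sinD.
  have -> : (sin al * cos be + cos al * sin be) * (p * s * (q * p)) = k * n.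
    transitivity (sin al * (p * s) * (cos be * (q * p)) +
                  cos al * (p * s) * (sin be * (q * p))); first by ring.
    by rewrite cal cbe sal sbe -dotD; ring.
  by rewrite mulr_gt0 // -pn exprn_gt0.
have lt_pi : al + be < pi.
  rewrite ltNge; apply: contraL sin0 => ge_pi; rewrite -leNgt.
  rewrite -[al + be](subrK pi) sinDpi oppr_le0 sin_ge0_pi //.
  by lra.
suff -> : al + be = pi - ga by rewrite subrK.
apply: cos_inj; rewrite ?in_itv /=; [by lra | by lra |].
by rewrite cosE cosB cospi sinpi; ring.
Qed.

(** * Sides of the pedal triangle at the foot of the altitude from [A] *)

Section Feet.
Variables A B C : R[i].
Let u := B - A.
Let v := C - A.
Let w := C - B.
Let U := foot B C A - foot A B C.
Let V := foot C A B - foot A B C.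
Hypothesis uv : crossc u v != 0.

(** Seen from [A], the feet on [CA] and [AB] are multiples of [v] and [u], and the foot on [BC] is a
    multiple of [w] turned by a right angle. *)
Let feetE : [/\ dotc u u != 0, dotc v v != 0, dotc w w != 0,
   U = (dotc u v / dotc v v)%:C%C * v
       - (crossc u v / dotc w w)%:C%C * (complex.Im w +i* - complex.Re w)%C &
   V = (dotc u v / dotc u u)%:C%C * u
       - (crossc u v / dotc w w)%:C%C * (complex.Im w +i* - complex.Re w)%C].
Proof.
have u0 := dotc_gt0 uv.
have v0 : 0 < dotc v v by apply: (@dotc_gt0 v u); rewrite crossc_swap oppr_eq0.
have w0 : 0 < dotc w w.
  apply: (@dotc_gt0 w u); suff -> : crossc w u = - crossc u v by rewrite oppr_eq0.
  by rewrite /w /u /v; case: (A) (B) (C) => [? ?] [? ?] [? ?]; rewrite /crossc /=; ring.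
rewrite !lt0r_neq0 //.
split=> //; move: u0 v0 w0 => /lt0r_neq0 + /lt0r_neq0 + /lt0r_neq0.
all: rewrite ?/U ?/V /foot /u /v /w; case: (A) (B) (C) => [? ?] [? ?] [? ?].
all: rewrite /dotc /crossc /= => u0 v0 w0; congr (_ +i* _)%C; field.
all: by rewrite ?u0 ?v0 ?w0.
Qed.

(** The last factor of [dotc U V] is the cosine of twice the angle at [A], so the cosine of the
    pedal angle agrees with it up to sign. [crossc U V] vanishes only if some angle of [ABC] is
    right. *)
Lemma feet_dotc_crossc :
  [/\ dotc U U = dotc u u * dotc v w ^+ 2 / (dotc v v * dotc w w),
      dotc V V = dotc v v * dotc u w ^+ 2 / (dotc u u * dotc w w),
      dotc U V = dotc v w * dotc u w / dotc w w *
                 ((2 * dotc u v ^+ 2 - dotc u u * dotc v v) / (dotc u u * dotc v v)) &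
      crossc U V = - (2 * dotc u v * dotc v w * dotc u w * crossc u v) /
                   (dotc u u * dotc v v * dotc w w)].
Proof.
have [u0 v0 w0 -> ->] := feetE.
have wE : w = v - u by rewrite /w /u /v; ring.
move: u0 v0 w0; rewrite {}wE.
case: (u) (v) => [u1 u2] [v1 v2]; rewrite /dotc /crossc /= => u0 v0 w0.
by split; field; rewrite ?u0 ?v0 ?w0.
Qed.

Lemma feet_crossc_neq0 : dotc u v != 0 -> dotc v w != 0 -> dotc u w != 0 ->
  crossc U V != 0.
Proof.
move=> uv0 vw0 uw0; have [u0 v0 w0 _ _] := feetE.
have [_ _ _ ->] := feet_dotc_crossc.
by rewrite mulf_neq0 ?invr_neq0 ?oppr_eq0 ?mulf_neq0 ?pnatr_eq0.
Qed.

(** Doubling brings in squared cosines, which lose the sign of [dotc v w * dotc u w] and with it the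
    distinction between acute and obtuse. *)
Lemma cos_vangle_feet : dotc u v != 0 -> dotc v w != 0 -> dotc u w != 0 ->
  cos (vangle U V *+ 2) = cos (vangle u v *+ 2 *+ 2).
Proof.
move=> uv0 vw0 uw0; have UV := feet_crossc_neq0 uv0 vw0 uw0.
have [u0 v0 w0 _ _] := feetE; rewrite !cos_mulr2n.
rewrite (sqr_cos_vangle UV) (sqr_cos_vangle uv).
have [-> -> -> _] := feet_dotc_crossc.
by congr (_ *+ 2 - 1); field; rewrite ?u0 ?v0 ?w0 ?vw0 ?uw0.
Qed.

End Feet.
End Triangles.

(** * Area, flatness and ordered shapes of indexed triangles *)

Section PedalTriangle.
Variable R : realType.
Implicit Types (T : 'I_3 -> R[i]) (i : 'I_3).

Definition area2 T i : R := crossc (T (i + 1) - T i) (T (i + 2) - T i).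

Lemma ord3_add i :
  [/\ i + 1 + 1 = i + 2, i + 1 + 2 = i, i + 2 + 1 = i & i + 2 + 2 = i + 1].
Proof. by elim/ord3P: i; split; apply: val_inj. Qed.

Lemma ord3_add0 : (0 + 1 = 1 :> 'I_3) * (0 + 2 = 2 :> 'I_3).
Proof. by split; apply: val_inj. Qed.

Lemma area2_rot T i : area2 T i = area2 T 0.
Proof.
have rot j : area2 T (j + 1) = area2 T j.
  rewrite /area2; have [-> -> _ _] := ord3_add j.
  case: (T j) (T (j + 1)) (T (j + 2)) => [? ?] [? ?] [? ?].
  by rewrite /crossc /=; ring.
elim/ord3P: i => //; first by rewrite -[in RHS]rot ord3_add0.
by rewrite -ord3_add0 -(rot 0) -(rot (0 + 1)); have [-> _ _ _] := ord3_add 0.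
Qed.

Lemma flat_area2 T : flat T -> area2 T 0 = 0.
Proof.
move=> [p [q [_ pqT]]]; rewrite /area2.
have [[[r _ <-] [s _ <-]] [t _ <-]] := (pqT 0, pqT (0 + 1), pqT (0 + 2)).
by case: p q {pqT} => [? ?] [? ?]; rewrite /crossc /=; ring.
Qed.

Lemma area2_triangle T : area2 T 0 != 0 -> is_triangle T /\ ~ flat T.
Proof.
move=> T0; split=> [|/flat_area2 e]; last by rewrite e eqxx in T0.
move=> i j; apply: contra_eq => ij; apply: contra T0 => /eqP Tij.
(* Distinct indices modulo 3 differ by 1 or 2; coinciding vertices make an edge vector at [i]
   zero. *)
have [|] : j = i + 1 \/ j = i + 2; last first.
- move=> e; rewrite -(area2_rot T i) /area2 -e -Tij subrr.
  by rewrite /crossc /= !mulr0 subrr.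
- move=> e; rewrite -(area2_rot T i) /area2 -e -Tij subrr.
  by rewrite /crossc /= !mul0r subrr.
by move: ij; elim/ord3P: i {Tij}; elim/ord3P: j => // _;
  ((left; exact: val_inj) || (right; exact: val_inj)).
Qed.

Lemma area2_neq0 T : is_triangle T -> ~ flat T -> area2 T 0 != 0.
Proof.
move=> Tinj; apply: contra_notN => /eqP; rewrite /area2 !ord3_add0 => T0.
have T01 : T 0 != T 1 by rewrite (inj_eq Tinj).
exists (T 0), (T 1); split=> //; apply: ord3P.
- by exists 0 => //; rewrite mul0r addr0.
- by exists 1 => //; rewrite mul1r addrC subrK.
(* The parameter of the orthogonal projection of [T 2] onto the line; zero area makes that
   projection [T 2] itself. *)
exists (dotc (T 2 - T 0) (T 1 - T 0) / dotc (T 1 - T 0) (T 1 - T 0)) => //.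
have : dotc (T 1 - T 0) (T 1 - T 0) != 0.
  apply: contra T01; rewrite -sqr_vnorm sqrf_eq0 /vnorm normc_def /=.
  rewrite sqrtr_eq0 => le0; rewrite eq_sym -subr_eq0.
  have : complex.Re (T 1 - T 0) ^+ 2 + complex.Im (T 1 - T 0) ^+ 2 == 0.
    by rewrite eq_le le0 addr_ge0 ?sqr_ge0.
  by rewrite paddr_eq0 ?sqr_ge0 // !sqrf_eq0 eq_complex.
move: T0; case: (T 0) (T 1) (T 2) {T01} => [a b] [c d] [e f].
rewrite /crossc /dotc /= => T0 n0; apply/eqP; rewrite eq_complex /=; apply/andP.
have kE : (c - a) * (f - b) = (d - b) * (e - a) by lra.
split; apply/eqP; apply: (mulIf n0).
- transitivity (a * ((c - a) * (c - a) + (d - b) * (d - b)) +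
    ((e - a) * (c - a) * (c - a) + (f - b) * (c - a) * (d - b))).
    by field.
  by rewrite [(f - b) * _]mulrC kE; ring.
- transitivity (b * ((c - a) * (c - a) + (d - b) * (d - b)) +
    ((d - b) * (e - a) * (c - a) + (f - b) * (d - b) * (d - b))).
    by field.
  by rewrite -kE; ring.
Qed.

Lemma angleE T i :
  angle T i = vangle (T (i + 1) - T i) (T (i + 2) - T i) / pi.
Proof. by []. Qed.

Lemma nonright_dotc_neq0 T i : ~ right_triangle T ->
  dotc (T (i + 1) - T i) (T (i + 2) - T i) != 0.
Proof.
apply: contra_notN => /eqP d0; exists i.
by rewrite angleE /vangle d0 mul0r acos0 mulrAC divff ?gt_eqF ?pi_gt0.
Qed.

Lemma image_ord3 (S : Type) (F : 'I_3 -> S) :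
  [seq F i | i : 'I_3] = [:: F 0; F 1; F 2].
Proof.
rewrite /image_mem !enum_ordSl enum_ord0 /=.
by congr [:: F _; F _; F _]; apply: val_inj.
Qed.

Lemma angle_ge0 T i : area2 T 0 != 0 -> 0 <= angle T i.
Proof.
rewrite -(area2_rot T i) => /vangle_itv /andP[a0 _].
by rewrite angleE divr_ge0 ?pi_ge0.
Qed.

Lemma angle_sum T : area2 T 0 != 0 -> angle T 0 + angle T 1 + angle T 2 = 1.
Proof.
rewrite /area2 => /vangle_sum; rewrite !angleE -!mulrDl.
have [+ + + +] := ord3_add 0; rewrite !ord3_add0 => -> -> -> -> ->.
by rewrite divff // gt_eqF ?pi_gt0.
Qed.

(** Replaces the sorted list by what later arguments use: its order and its multiset of angles. *)
Lemma ordered_shapeE T : exists x y z,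
  [/\ ordered_shape T = col3 x y z, y <= x, z <= y &
      perm_eq [:: x; y; z] [:: angle T 0; angle T 1; angle T 2]].
Proof.
rewrite /ordered_shape image_ord3; set s := [:: _; _; _].
have := sort_sorted (@ge_total _ R) s; have := size_sort >=%R s.
have /permPl := perm_sort >=%R s.
case: (sort _ s) => [|x [|y [|z []]]] //= e _ /and3P[yx zy _].
by exists x, y, z; split.
Qed.

Lemma ordered_shape_domD T : area2 T 0 != 0 -> domD R (ordered_shape T).
Proof.
move=> T0; have [x [y [z [-> yx zy e]]]] := ordered_shapeE T.
rewrite domD_col3; split=> //.
  have : \sum_(a <- [:: x; y; z]) a =
         \sum_(a <- [:: angle T 0; angle T 1; angle T 2]) a by exact: perm_big.
  by rewrite !big_cons !big_nil !addr0 !addrA => ->; exact: angle_sum.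
have : z \in [:: x; y; z] by rewrite !inE eqxx !orbT.
by rewrite (perm_mem e) !inE => /or3P[] /eqP ->; exact: angle_ge0.
Qed.

Lemma pedal_angles T i :
  let A := T i in let B := T (i + 1) in let C := T (i + 2) in
  pedal T (i + 1) - pedal T i = foot B C A - foot A B C /\
  pedal T (i + 2) - pedal T i = foot C A B - foot A B C.
Proof. by rewrite /pedal; have [-> -> -> ->] := ord3_add i. Qed.

Section Nonright.
Variable T : 'I_3 -> R[i].
Hypothesis Ttri : area2 T 0 != 0.
Hypothesis Tright : ~ right_triangle T.

(** The non-right angles at all three vertices, rewritten up to sign in the edges based at [i] that
    the feet formulas use. *)
Let dots i : let A := T i in let B := T (i + 1) in let C := T (i + 2) in
  [/\ dotc (B - A) (C - A) != 0, dotc (C - A) (C - B) != 0 &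
      dotc (B - A) (C - B) != 0].
Proof.
move=> A B C; split; first exact: nonright_dotc_neq0.
  have := nonright_dotc_neq0 (i + 2) Tright; have [_ _ -> ->] := ord3_add i.
  by rewrite -(opprB C A) -(opprB C B) /dotc !raddfN !mulrNN.
have := nonright_dotc_neq0 (i + 1) Tright; have [-> -> _ _] := ord3_add i.
by rewrite -(opprB B A) /dotc !raddfN !mulrN -opprD oppr_eq0 ![_ (C - B) * _]mulrC.
Qed.

Lemma pedal_area2_neq0 : area2 (pedal T) 0 != 0.
Proof.
have [d1 d2 d3] := dots 0; rewrite /area2.
have [-> ->] := pedal_angles T 0; exact: feet_crossc_neq0.
Qed.

Lemma cos_angle_pedal i :
  cos (2 * angle (pedal T) i * pi) = cos (2 * (1 - 2 * angle T i) * pi).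
Proof.
have [d1 d2 d3] := dots i; rewrite !angleE.
have [-> ->] := pedal_angles T i.
have piK (a : R) : 2 * (a / pi) * pi = a *+ 2.
  by rewrite -mulrA divfK ?gt_eqF ?pi_gt0 // mulr_natl.
(* Folding replaces [1 - 2 a] by [2 a], giving the quadrupled angle of [cos_vangle_feet]. *)
rewrite (@cos_2pi_sub _ (1 - _) (2 * (vangle (T (i + 1) - T i) (T (i + 2) - T i) / pi))).
  by rewrite -(mulrA 2 (2 * _)) !piK mulr_natl cos_vangle_feet // -/(area2 T i) area2_rot.
by rewrite subrK.
Qed.

(** Sorting only permutes entries, so vertexwise equality of cosines suffices, in whatever order the
    pedal angles fall. *)
Lemma cosines_ordered_shape_pedal :
  perm_eq (cosines (pedal_mx R *m ordered_shape T))
          (cosines (ordered_shape (pedal T))).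
Proof.
have := ordered_shape_domD Ttri.
have [x [y [z [-> _ _ e]]]] := ordered_shapeE T.
have [x' [y' [z' [-> _ _ e']]]] := ordered_shapeE (pedal T).
rewrite domD_col3 pedal_mx_col3 => -[-> _ _ _]; rewrite !cosines_col3.
have := perm_map (fun a => cos (2 * (1 - 2 * a) * pi)) e.
move=> /perm_trans; apply; rewrite /= -!cos_angle_pedal perm_sym.
exact: (perm_map (fun a => cos (2 * a * pi)) e').
Qed.

End Nonright.
End PedalTriangle.

(** Both representatives share the cosines of [u]; this yields the singleton condition of
    [linear_triangle_map]. *)
Lemma domD_simA_uniq (R : realType) (u v w : 'cV[R]_3) : planeA u ->
  domD R v -> domD R w -> simA u v -> simA u w -> v = w.
Proof.
move=> Au Dv Dw [g Gg ev] [h Gh ew]; apply: cosines_domD_inj => //.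
rewrite ev ew; apply: perm_trans (cosines_groupG Gg Au) _.
by rewrite perm_sym cosines_groupG.
Qed.

Theorem corollary1 (R : realType) :
  exists Pt : {fun domD R >-> domD R},
    linear_triangle_map Pt /\
    forall T : 'I_3 -> R[i],
      is_triangle T -> ~ flat T -> ~ right_triangle T ->
      [/\ is_triangle (pedal T), ~ flat (pedal T) &
          Pt (ordered_shape T) = ordered_shape (pedal T)].
Proof.
have /choice[f fP] : forall v : 'cV[R]_3, exists w,
    domD R v -> domD R w /\ simA (pedal_mx R *m v) w.
  (* Choice needs a value for every column; outside [D] any value will do. *)
  move=> v; have [Dv|nDv] := pselect (domD R v); last by exists v.
  by have [w Dw sw] := simA_pedal_domD Dv; exists w.
have fD : {homo f : v / domD R v >-> domD R v} by move=> v /fP[].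
have DA v : domD R v -> planeA v by case.
exists (mkfun_fun fD); split.
  exists (pedal_mx R); split.
  - exact: pedal_mx_unit.
  - exact: pedal_mx_planeA.
  - by move=> v v' _ _; exact: simA_pedal_mx.
  move=> v Dv; have [Dfv sfv] := fP v Dv; apply/seteqP; split=> w /=.
    by move=> [Dw sw]; apply: domD_simA_uniq sw sfv => //; apply/pedal_mx_planeA/DA.
  by move=> ->; split.
move=> T Tinj Tflat Tright; have T0 := area2_neq0 Tinj Tflat.
have T'0 := pedal_area2_neq0 T0 Tright.
have [T'inj T'flat] := area2_triangle T'0; split=> //=.
have D := ordered_shape_domD T0; have [Df [g Gg ef]] := fP _ D.
apply: cosines_domD_inj => //; first exact: ordered_shape_domD.
rewrite /mkfun ef; apply: perm_trans (cosines_ordered_shape_pedal T0 Tright).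
by apply: cosines_groupG => //; apply/pedal_mx_planeA/DA.
Qed.
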